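(* Let $\hat{\boldsymbol{\beta}}_{\mu}=(X^TX+\mu I_{d_0})^{-1}X^Ty$ be the ridge regression estimator with ridge parameter $\mu$ applied to the data $(y,X)$, and let $\hat{\boldsymbol{\beta}}_{(n),\mu}$ be the ridge regression estimator with ridge parameter $\mu$ computed along sequence II, as defined in the context. Under sequence II with $n_0=n\nu$, where $0<\nu<1$, $$\|\hat{\boldsymbol{\beta}}_{(n),n\lambda}-\hat{\boldsymbol{\beta}}_{n(1-\nu+\lambda)}\|=O_p(n^{-1/2})\quad\text{as } n\to\infty.$$ Here $\hat{\boldsymbol{\beta}}_{(n),n\lambda}$ is $\hat{\boldsymbol{\beta}}_{(n),\mu}$ with $\mu=n\lambda$, and $\hat{\boldsymbol{\beta}}_{n(1-\nu+\lambda)}$ is $\hat{\boldsymbol{\beta}}_{\mu}$ with $\mu=n(1-\nu+\lambda)$; the real parameter $\lambda$ may be positive, zero or negative.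
   Context: Data model: $X$ is an $n_0\times d_0$ random matrix whose rows are independent $N_{d_0}(0,I_{d_0})$; $y=X\boldsymbol{\beta}_0+e$ with $e\sim N_{n_0}(0,\sigma^2I_{n_0})$, where $\boldsymbol{\beta}_0\in\mathbb{R}^{d_0}$ is an unknown regression parameter and $\sigma^2>0$ is an unknown variance parameter. Sequence II (adding noise observations; $n$ increases with the number of predictors $d=d_0$ fixed): for $n>n_0$ the training set is $([y^T,0_{n-n_0}^T]^T,[X^T,W^T]^T)$, where $W$ is an $(n-n_0)\times d_0$ matrix with independent $N_{d_0}(0,I_{d_0})$ rows that are independent of $X$ and $e$. The ridge regression estimator with ridge parameter $\mu$ applied to this training set is $\hat{\boldsymbol{\beta}}_{(n),\mu}=(X^TX+W^TW+\mu I_{d_0})^{-1}X^Ty$. $\|\cdot\|$ is the Euclidean norm, and $O_p$ denotes order in probability.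
   Formalization: The case λ = −1 is excluded: there both matrices, divided by n, tend to 0, and e.g. for d_0 = 1 and β_0 ≠ 0 the difference has order n^{1/2}, so the claim fails. *)

(* Defs.v *)
From HB Require Import structures.
From mathcomp Require Import all_boot all_order all_algebra.
From mathcomp Require Import all_classical all_reals all_analysis.
Set Implicit Arguments.
Unset Strict Implicit.
Unset Printing Implicit Defensive.
Import Order.TTheory GRing.Theory Num.Theory.
Import numFieldNormedType.Exports.
Local Open Scope classical_set_scope.
Local Open Scope ring_scope.

(* ['M[R]_(m, n)] carries no measurable structure in the library; this alias
   equips it with its Borel sigma-algebra. *)
Definition borelM (R : realType) (m n : nat) :=
  g_sigma_algebraType (@open 'M[R]_(m, n)).

Definition l2norm (R : realType) (m : nat) (v : 'cV[R]_m) : R :=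
  Num.sqrt (\sum_(i < m) v i 0 ^+ 2).

(* For a finite family, the product rule for the whole family implies it for
   each subfamily: take [A i := setT] outside the subfamily. *)
Definition independent_family (R : realType) (dT : measure_display)
    (T : measurableType dT) (P : probability T R) (I : finType)
    (dV : measure_display) (V : measurableType dV) (Z : I -> T -> V) : Prop :=
  forall A : I -> set V, (forall i, measurable (A i)) ->
    P (\bigcap_(i in [set: I]) Z i @^-1` A i)
    = (\prod_(i : I) fine (P (Z i @^-1` A i)))%:E.

Definition independent2 (R : realType) (dT : measure_display)
    (T : measurableType dT) (P : probability T R)
    (dU : measure_display) (U : measurableType dU)
    (dV : measure_display) (V : measurableType dV)
    (Y : T -> U) (Z : T -> V) : Prop :=
  forall (A : set U) (B : set V), measurable A -> measurable B ->
    P (Y @^-1` A `&` Z @^-1` B) = (P (Y @^-1` A) * P (Z @^-1` B))%E.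

(* N(m, v) parametrized by its variance. The library's [normal_prob m s] takes
   the standard deviation and is a uniform law, not a point mass, at [s = 0]. *)
Definition normal_law (R : realType) (m v : R) (A : set R) : \bar R :=
  if v == 0 then \d_m A else normal_prob m (Num.sqrt v) A.

(* Z ~ N_m(mu, Sigma): each linear combination a^T Z is univariate normal
   N(a^T mu, a^T Sigma a). *)
Definition multivariate_normal (R : realType) (dT : measure_display)
    (T : measurableType dT) (P : probability T R) (m : nat)
    (Z : T -> 'cV[R]_m) (mu : 'cV[R]_m) (Sigma : 'M[R]_m) : Prop :=
  forall (a : 'cV[R]_m) (A : set R), measurable A ->
    P [set t | A ((a^T *m Z t) 0 0)]
    = normal_law ((a^T *m mu) 0 0) ((a^T *m Sigma *m a) 0 0) A.

Record standard_normal_rows (R : realType) (dT : measure_display)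
    (T : measurableType dT) (P : probability T R) (m d : nat)
    (X : T -> 'M[R]_(m, d)) : Prop := {
  snr_measurable : measurable_fun [set: T] (X : T -> borelM R m d);
  snr_normal : forall i : 'I_m,
    multivariate_normal P (fun t => (row i (X t))^T) 0 1%:M;
  snr_independent :
    independent_family P (fun (i : 'I_m) t => row i (X t) : borelM R 1 d)
}.

(* Independence of [X] and [e] is deliberately not required. *)
Record sequenceII (R : realType) (dT : measure_display)
    (T : measurableType dT) (P : probability T R) (d0 n0 n : nat) (sigma2 : R)
    (X : T -> 'M[R]_(n0, d0)) (e : T -> 'cV[R]_n0)
    (W : T -> 'M[R]_(n - n0, d0)) : Prop := {
  sII_X : standard_normal_rows P X;
  sII_e_measurable : measurable_fun [set: T] (e : T -> borelM R n0 1);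
  sII_e_normal : multivariate_normal P e 0 sigma2%:M;
  sII_W : standard_normal_rows P W;
  sII_independent : independent2 P (W : T -> borelM R (n - n0) d0)
    (fun t => (X t : borelM R n0 d0, e t : borelM R n0 1))
}.

Definition response (R : realType) (n0 d0 : nat) (X : 'M[R]_(n0, d0))
    (beta0 : 'cV[R]_d0) (e : 'cV[R]_n0) : 'cV[R]_n0 := X *m beta0 + e.

(* [invmx] is total: it returns its argument on a singular matrix. *)
Definition ridge (R : realType) (m d : nat) (mu : R) (y : 'cV[R]_m)
    (X : 'M[R]_(m, d)) : 'cV[R]_d :=
  invmx (X^T *m X + mu%:M) *m X^T *m y.

Definition ridgeII (R : realType) (n0 p d : nat) (mu : R) (y : 'cV[R]_n0)
    (X : 'M[R]_(n0, d)) (W : 'M[R]_(p, d)) : 'cV[R]_d :=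
  ridge mu (col_mx y (0 : 'cV[R]_p)) (col_mx X W).

Lemma ridgeIIE (R : realType) (n0 p d : nat) (mu : R) (y : 'cV[R]_n0)
    (X : 'M[R]_(n0, d)) (W : 'M[R]_(p, d)) :
  ridgeII mu y X W = invmx (X^T *m X + W^T *m W + mu%:M) *m X^T *m y.
Proof.
by rewrite /ridgeII /ridge tr_col_mx mul_row_col -!mulmxA mul_row_col mulmx0 addr0.
Qed.

(* Z_k = O_p(r_k) as k tends to infinity; each Z_k may live on its own
   probability space. *)
Definition bigO_p (R : realType) (dT : nat -> measure_display)
    (T : forall k, measurableType (dT k)) (P : forall k, probability (T k) R)
    (Z : forall k, T k -> R) (r : nat -> R) : Prop :=
  forall eps : R, 0 < eps -> exists2 M : R, 0 < M &
    \forall k \near \oo, (P k [set t | (M * r k < `|Z k t|)%R] <= eps%:E)%E.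

(* Main.v *)
Require Import Defs.
From HB Require Import structures.
From mathcomp Require Import all_boot all_order all_algebra.
From mathcomp Require Import all_classical all_reals all_analysis.
From mathcomp Require Import measurable_realfun.
From mathcomp Require Import ring lra.
Import Order.TTheory GRing.Theory Num.Theory.
Import numFieldNormedType.Exports.
Local Open Scope classical_set_scope.
Local Open Scope ring_scope.

Set Implicit Arguments.
Unset Strict Implicit.
Unset Printing Implicit Defensive.

(** Write [n], [n0] for the sizes at stage [k], [c = n (1 + lambda)] and
    [u = X^T y]. The two estimators are [A^-1 u] and [B^-1 u] with

      [A = X^T X + W^T W + n lambda I], [B = X^T X + n (1 - nu + lambda) I].

    By the law of large numbers [X^T X] is close to [n0 I] and [W^T W] to
    [(n - n0) I], with errors of order [sqrt n], so that both [A] and [B] are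
    [c I] up to [O(sqrt n)]. As [lambda <> -1], both are eventually invertible
    with inverses of order [1/n]. Since [u = O(n)], and

      [A (A^-1 u - B^-1 u) = (B - A) B^-1 u],

    with [B - A = (n0 - n nu) I - (W^T W - (n - n0) I) = O(sqrt n)], the
    difference is of order [n^-1 . n^(1/2) . n^-1 . n = n^(-1/2)]. This is
    the deterministic [ridge_difference_le].

    All the randomness goes through one nonnegative variable, [total_dev]: the
    sum of the squared errors [(|X a|^2 - n0)^2] and [(|W a|^2 - (n - n0))^2]
    over finitely many unit vectors [a], and of [|e|^2]. Polarization
    ([gram_dev_le]) recovers the entries of the Gram matrices from the [a], and
    since every [a] is a unit vector only the law N(0, 1) ever occurs. The
    expectation of [total_dev] is [O(n)] ([integral_total_dev_le]), because
    [|X a|^2 - n0] is a sum of centred variables which are pairwise independent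
    ([integral_chi2_sqr_le]). Markov's inequality, applied once to [total_dev],
    then shows that the hypotheses of [ridge_difference_le] hold with
    probability as close to 1 as desired.

    The moments of N(0, 1) come from the integral of [exp (a x^2)], which the
    normalization of the centred normal densities gives for every [a < 1/2]
    ([normal_integral_expR_sqr]). *)

(** * Moments of the standard normal law *)

(** [normal_prob] is given by its density set by set; almost everywhere
    uniqueness of the Radon-Nikodym derivative extends this to integrals. *)
Lemma ge0_integral_normal_prob (R : realType) (m s : R) (f : measurableTypeR R -> \bar R) :
    (forall x, 0 <= f x)%E -> measurable_fun [set: measurableTypeR R] f ->
  (\int[normal_prob m s]_x f x =
   \int[lebesgue_measure]_x (f x * (normal_pdf m s x)%:E))%E.
Proof.
move=> f0 mf.
have dom : (normal_prob m s : {measure set _ -> \bar R}) `<< lebesgue_measure.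
  exact: normal_prob_dominates.
rewrite -(Radon_Nikodym_SigmaFinite.change_of_variables dom)//.
have mRN := measurable_int _ (Radon_Nikodym_SigmaFinite.f_integrable dom).
have mpdf : measurable_fun [set: measurableTypeR R] (fun x => (normal_pdf m s x)%:E).
  by apply/measurable_EFinP; exact: measurable_normal_pdf.
apply: ae_eq_integral => //; [exact: emeasurable_funM|exact: emeasurable_funM|].
apply: ae_eqe_mul2l; apply: integral_ae_eq => //.
  exact: Radon_Nikodym_SigmaFinite.f_integrable.
by move=> E _ mE; rewrite -Radon_Nikodym_SigmaFinite.f_integral.
Qed.

(** [exp (a x^2)] times the N(0, 1) density is [s] times the N(0, s^2) density,
    for [s = (1 - 2 a)^(-1/2)]. *)
Lemma normal_integral_expR_sqr (R : realType) (a : R) : a < 2^-1 ->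
  (\int[normal_prob 0 1]_x (expR (a * x ^+ 2))%:E
   = ((Num.sqrt (1 - 2 * a))^-1)%:E :> \bar R)%E.
Proof.
move=> a12; have u0 : 0 < 1 - 2 * a by lra.
have su0 : 0 < Num.sqrt (1 - 2 * a) by rewrite sqrtr_gt0.
pose s : R := (Num.sqrt (1 - 2 * a))^-1.
have s0 : 0 < s by rewrite invr_gt0.
have s2 : s ^+ 2 = (1 - 2 * a)^-1 by rewrite exprVn sqr_sqrtr// ltW.
rewrite ge0_integral_normal_prob//; last first.
  apply/measurable_EFinP; apply: measurableT_comp => //.
  by apply: measurable_funM => //; exact: measurable_funX.
transitivity (\int[lebesgue_measure]_x (s%:E * (normal_pdf 0 s x)%:E))%E.
  apply: eq_integral => x _; rewrite -!EFinM; congr EFin.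
  rewrite !normal_pdfE ?gt_eqF// /normal_peak /normal_fun !subr0.
  rewrite -[s ^+ 2 * _ *+ 2]mulrnAr sqrtrM ?sqr_ge0// sqrtr_sqr gtr0_norm//.
  rewrite expr1n mul1r invfM [RHS]mulrA [X in _ = X * _]mulrA mulfV ?gt_eqF// mul1r mulrCA.
  rewrite -expRD; congr (_ * expR _).
  rewrite -[_ *+ 2 in RHS]mulr_natr s2 invfM invrK.
  by field.
rewrite ge0_integralZl//.
- by rewrite integral_normal_pdf mule1.
- by apply/measurable_EFinP; exact: measurable_normal_pdf.
- by move=> x _; rewrite lee_fin normal_pdf_ge0.
- by rewrite lee_fin ltW.
Qed.

Lemma linear_le_expR_sqr (R : realType) (a x : R) : a * x ^+ 2 + 1 <= expR (a * x ^+ 2).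
Proof. by rewrite addrC expR_ge1Dx. Qed.

(** Squaring [x^2 / 8 <= exp (x^2 / 8)]; the exponent [1/4] stays below the
    threshold [1/2] of [normal_integral_expR_sqr]. *)
Lemma exprn4_le_expR_sqr (R : realType) (x : R) :
  x ^+ 4 <= 64 * expR (4^-1 * x ^+ 2).
Proof.
have -> : 4^-1 * x ^+ 2 = 2%:R * (8^-1 * x ^+ 2) by field.
rewrite expRM_natl.
have h := linear_le_expR_sqr (8^-1) x.
have h8 : 0 <= 8^-1 * x ^+ 2 :> R by rewrite mulr_ge0 ?sqr_ge0.
rewrite -[leLHS](_ : 64 * (8^-1 * x ^+ 2) ^+ 2 = _); last by field.
rewrite ler_pM2l// lerXn2r ?nnegrE ?expR_ge0//.
lra.
Qed.

Lemma measurable_mulrX (R : realType) (a : R) (k : nat) :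
  measurable_fun [set: measurableTypeR R] (fun x : R => (a * x ^+ k)%:E).
Proof.
by apply/measurable_EFinP; apply: measurable_funM => //; exact: measurable_funX.
Qed.

Lemma measurable_expR_sqr (R : realType) (a : R) :
  measurable_fun [set: measurableTypeR R] (fun x : R => (expR (a * x ^+ 2))%:E).
Proof.
apply/measurable_EFinP; apply: measurableT_comp => //.
by apply: measurable_funM => //; exact: measurable_funX.
Qed.

Lemma normal_integral_exprn4_lty (R : realType) :
  (\int[normal_prob 0 1]_x (x ^+ 4)%:E < +oo :> \bar R)%E.
Proof.
apply: (@le_lt_trans _ _
  (\int[normal_prob 0 1]_x (64%:E * (expR (4^-1 * x ^+ 2))%:E))%E).
  apply: ge0_le_integral => //.
  - by move=> x _; rewrite lee_fin exprn_even_ge0.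
  - by apply/measurable_EFinP; exact: measurable_funX.
  - by apply: emeasurable_funM => //; exact: measurable_expR_sqr.
  - by move=> x _; rewrite -EFinM lee_fin exprn4_le_expR_sqr.
rewrite ge0_integralZl//; last exact: measurable_expR_sqr.
by rewrite normal_integral_expR_sqr ?ltry//; lra.
Qed.

(** Integrating [1 + a x^2 <= exp (a x^2)] gives
    [1 + a m <= (1 - 2 a)^(-1/2)] for the second moment [m] and every
    [a < 1/2]. Both sides are 1 at [a = 0], where their derivatives are [m] and
    1; letting [a] tend to 0 from either side gives [m <= 1] and [m >= 1]. *)
Lemma normal_integral_sqr (R : realType) :
  (\int[normal_prob 0 1]_x (x ^+ 2)%:E = 1 :> \bar R)%E.
Proof.
set N : probability _ R := normal_prob 0 1.
set M := (\int[N]_x (x ^+ 2)%:E)%E.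
have mX2 : measurable_fun [set: measurableTypeR R] (fun x : R => (x ^+ 2)%:E).
  by apply/measurable_EFinP; exact: measurable_funX.
have M0 : (0 <= M)%E by apply: integral_ge0 => x _; rewrite lee_fin sqr_ge0.
have MZ (b : R) : 0 <= b -> (\int[N]_x (b * x ^+ 2)%:E = b%:E * M)%E.
  by move=> b0; rewrite -ge0_integralZl// => x _; rewrite lee_fin sqr_ge0.
have N1 : (\int[N]_x 1%:E = 1)%E.
  by rewrite integral_cst// mul1e; exact: probability_setT N.
(* The case a = b >= 0. *)
have up (b : R) : 0 <= b -> b < 2^-1 ->
    (1 + b%:E * M <= ((Num.sqrt (1 - 2 * b))^-1)%:E)%E.
  move=> b0 b2; rewrite -normal_integral_expR_sqr// -/N -MZ// -[X in (X + _)%E]N1.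
  rewrite -ge0_integralD//; last 2 first.
  - by move=> x _; rewrite lee_fin mulr_ge0 ?sqr_ge0.
  - exact: measurable_mulrX.
  apply: ge0_le_integral => //.
  - move=> x _; rewrite -EFinD lee_fin.
    by apply: addr_ge0; [exact: ler01|exact: mulr_ge0 b0 (sqr_ge0 x)].
  - by apply: emeasurable_funD => //; exact: measurable_mulrX.
  - exact: measurable_expR_sqr.
  - by move=> x _; rewrite -EFinD lee_fin addrC linear_le_expR_sqr.
(* The case a = - b <= 0; moving b x^2 to the right keeps integrands nonnegative. *)
have lo (b : R) : 0 <= b ->
    (1 <= ((Num.sqrt (1 + 2 * b))^-1)%:E + b%:E * M)%E.
  move=> b0; have -> : 1 + 2 * b = 1 - 2 * (- b) by ring.
  have bl : - b < 2^-1 by lra.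
  rewrite -(normal_integral_expR_sqr bl).
  rewrite -/N -MZ// -[X in (X <= _)%E]N1 -ge0_integralD//; last 3 first.
  - exact: measurable_expR_sqr.
  - by move=> x _; rewrite lee_fin mulr_ge0 ?sqr_ge0.
  - exact: measurable_mulrX.
  apply: ge0_le_integral => //.
  - apply: emeasurable_funD; [exact: measurable_expR_sqr|exact: measurable_mulrX].
  - move=> x _; rewrite -EFinD lee_fin.
    by have := linear_le_expR_sqr (- b) x; lra.
have Mfin : M \is a fin_num.
  rewrite ge0_fin_numE//.
  have h4 : 4^-1 < 2^-1 :> R by lra.
  have h40 : 0 <= 4^-1 :> R by [].
  have := up _ h40 h4; case: (M) M0 => [r _ _|_|//]; first exact: ltry.
  by rewrite gt0_muley ?lte_fin// addey// leye_eq.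
move: up lo M0; rewrite -(fineK Mfin); set m := fine M => up lo.
rewrite lee_fin => m0; congr EFin; apply/eqP; rewrite eq_le.
apply/andP; split; rewrite leNgt; apply/negP => mlt.
(* Were m > 1, this b is small enough for the first-order term to dominate. *)
- pose b := (m - 1) / (4 * m + 2 * m ^+ 2).
  have d0 : 0 < 4 * m + 2 * m ^+ 2 by rewrite addr_gt0 ?mulr_gt0 ?exprn_gt0//; lra.
  have b0 : 0 < b by rewrite divr_gt0//; lra.
  have bd : b * (4 * m + 2 * m ^+ 2) = m - 1 by rewrite divfK// gt_eqF.
  have b2 : b < 2^-1.
    by rewrite ltr_pdivrMr//; nra.
  clearbody b.
  have := up b (ltW b0) b2; rewrite -EFinM -EFinD lee_fin.
  have v0 : 0 < 1 - 2 * b by lra.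
  have sv := sqrtr_gt0 (1 - 2 * b); rewrite v0 in sv.
  rewrite -[leRHS]mul1r ler_pdivlMr// => h.
  have : (1 + b * m) ^+ 2 * (1 - 2 * b) <= 1.
    rewrite -[X in _ * X](sqr_sqrtr (ltW v0)) -exprMn exprn_ile1//.
    apply: mulr_ge0; last exact: sqrtr_ge0.
    by apply: addr_ge0; [exact: ler01|exact: mulr_ge0 (ltW b0) m0].
  have -> : (1 + b * m) ^+ 2 * (1 - 2 * b) =
     1 + b * (2 * (m - 1) - b * (4 * m + 2 * m ^+ 2) + b * m ^+ 2
        + 2 * (b * (1 - b) * m ^+ 2)) by ring.
  rewrite bd gerDl leNgt => /negP; apply; rewrite mulr_gt0//.
  have h1 : 0 <= b * m ^+ 2 by rewrite mulr_ge0 ?sqr_ge0// ltW.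
  have h2 : 0 <= b * (1 - b) * m ^+ 2 by rewrite !mulr_ge0 ?sqr_ge0//; lra.
  lra.
(* Likewise when m < 1. *)
- pose b := (1 - m) / 4.
  have b0 : 0 < b by rewrite /b; lra.
  have := lo b (ltW b0); rewrite -EFinM -EFinD lee_fin.
  have v0 : 0 < 1 + 2 * b by lra.
  have sv := sqrtr_gt0 (1 + 2 * b); rewrite v0 in sv.
  rewrite -lerBlDr -[leRHS]mul1r ler_pdivlMr// => h.
  have bm0 : 0 <= 1 - b * m by rewrite /b; nra.
  have : (1 - b * m) ^+ 2 * (1 + 2 * b) <= 1.
    rewrite -[X in _ * X](sqr_sqrtr (ltW v0)) -exprMn exprn_ile1//.
    exact: mulr_ge0 bm0 (sqrtr_ge0 _).
  have -> : (1 - b * m) ^+ 2 * (1 + 2 * b) =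
     1 + b * (2 * (1 - m) - 4 * b * m + b * (1 + 2 * b) * m ^+ 2) by ring.
  rewrite gerDl leNgt => /negP; apply; rewrite mulr_gt0//.
  have h2 : 0 <= b * (1 + 2 * b) * m ^+ 2 by rewrite !mulr_ge0 ?sqr_ge0//; lra.
  have : b * m <= b by rewrite ler_piMr//; lra.
  rewrite /b in h2 *; lra.
Qed.

(** * Sums of squares of standard normal variables *)

Record std_normal_var (R : realType) (d : measure_display)
    (T : measurableType d) (P : probability T R) (Z : T -> R) : Prop := {
  std_normal_measurable : measurable_fun [set: T] (Z : T -> measurableTypeR R);
  std_normal_law : forall A : set (measurableTypeR R), measurable A ->
    P (Z @^-1` A) = normal_prob 0 1 A
}.

Lemma ge0_integral_std_normal (R : realType) (d : measure_display)
    (T : measurableType d) (P : probability T R) (Z : T -> R)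
    (f : measurableTypeR R -> \bar R) :
    std_normal_var P Z -> (forall x, 0 <= f x)%E ->
    measurable_fun [set: measurableTypeR R] f ->
  (\int[P]_t f (Z t) = \int[normal_prob 0 1]_x f x)%E.
Proof.
move=> [mZ lZ] f0 mf.
rewrite -(ge0_integral_pushforward mZ P measurableT mf)//.
by apply: eq_measure_integral => A mA _; exact: lZ.
Qed.

(** The joint law of an independent pair is the product of the marginals, so
    Tonelli factors the integral. *)
Lemma integral_sqr_mul_indep (R : realType) (d : measure_display)
    (T : measurableType d) (P : probability T R) (U V : T -> R) :
    std_normal_var P U -> std_normal_var P V ->
    independent2 P (U : T -> measurableTypeR R) (V : T -> measurableTypeR R) ->
  (\int[P]_t (U t ^+ 2 * V t ^+ 2)%:E = 1)%E.
Proof.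
move=> [mU lU] [mV lV] UV.
pose N : probability (measurableTypeR R) R := normal_prob 0 1.
pose W t : measurableTypeR R * measurableTypeR R := (U t, V t).
have mW : measurable_fun [set: T] W by exact: measurable_fun_pair.
have NW A : measurable A -> (N \x N)%E A = pushforward P W A.
  apply: (product_measure_unique (m' := pushforward P W)) => B C mB mC.
  rewrite /= /pushforward.
  have -> : W @^-1` (B `*` C) = U @^-1` B `&` V @^-1` C by [].
  by rewrite UV// lU// lV.
pose f (z : measurableTypeR R * measurableTypeR R) := (z.1 ^+ 2 * z.2 ^+ 2)%:E.
have mX2 : measurable_fun [set: measurableTypeR R] (fun x : R => x ^+ 2).
  exact: measurable_funX.
have mX2E : measurable_fun [set: measurableTypeR R] (fun x : R => (x ^+ 2)%:E).
  by apply/measurable_EFinP.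
have mf : measurable_fun setT f.
  apply/measurable_EFinP; apply: measurable_funM.
    by apply: measurable_funX; exact: measurable_fst.
  by apply: measurable_funX; exact: measurable_snd.
have f0 z : (0 <= f z)%E by rewrite lee_fin mulr_ge0 ?sqr_ge0.
transitivity (\int[pushforward P W]_z f z)%E.
  by rewrite (ge0_integral_pushforward mW P measurableT mf).
transitivity (\int[(N \x N)%E]_z f z)%E.
  by apply: eq_measure_integral => A mA _; exact: esym (NW A mA).
rewrite fubini_tonelli1// /fubini_F -[RHS](normal_integral_sqr R).
apply: eq_integral => x _; rewrite /f /=.
under eq_integral do rewrite EFinM.
rewrite ge0_integralZl//; last by rewrite lee_fin sqr_ge0.
  by rewrite normal_integral_sqr mule1.
by move=> y _; rewrite lee_fin sqr_ge0.
Qed.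

Lemma measurable_std_normal_exprn (R : realType) (d : measure_display)
    (T : measurableType d) (P : probability T R) (Z : T -> R) (k : nat) :
  std_normal_var P Z -> measurable_fun [set: T] (fun t => Z t ^+ k).
Proof. by move=> [mZ _]; exact: measurable_funX. Qed.

(** The variance of a sum of pairwise uncorrelated variables is the sum of the
    variances, each at most the fourth moment. Writing [S] for the sum of
    squares, the proof integrates [(S - m)^2 + 2 m S = S^2 + m^2], whose terms
    are all nonnegative, so that no integrability has to be checked. *)
Lemma integral_chi2_sqr_le (R : realType) (d : measure_display)
    (T : measurableType d) (P : probability T R) (m : nat)
    (Z : 'I_m -> T -> R) :
    (forall i, std_normal_var P (Z i)) ->
    (forall i j, i != j -> independent2 P (Z i : T -> measurableTypeR R)
                                          (Z j : T -> measurableTypeR R)) ->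
  (\int[P]_t ((\sum_(i < m) Z i t ^+ 2 - m%:R) ^+ 2)%:E
   <= m%:R%:E * \int[normal_prob 0 1]_x (x ^+ 4)%:E)%E.
Proof.
move=> nZ iZ; set q := (\int[normal_prob 0 1]_x (x ^+ 4)%:E)%E.
have q0 : (0 <= q)%E.
  by apply: integral_ge0 => x _; rewrite lee_fin exprn_even_ge0.
pose S t : R := \sum_(i < m) Z i t ^+ 2.
have mZ2 i : measurable_fun [set: T] (fun t => Z i t ^+ 2).
  exact: measurable_std_normal_exprn.
have mS : measurable_fun [set: T] S by apply: measurable_sum.
have S0 t : 0 <= S t by apply: sumr_ge0 => i _; exact: sqr_ge0.
have ES : (\int[P]_t (S t)%:E = m%:R%:E)%E.
  under eq_integral do rewrite /S -sumEFin.
  rewrite ge0_integral_sum//; last 2 first.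
  - by move=> i; apply/measurable_EFinP.
  - by move=> i t _; rewrite lee_fin sqr_ge0.
  rewrite (eq_bigr (fun=> 1%:E)) => [|i _].
    by rewrite sumEFin sumr_const card_ord.
  rewrite (ge0_integral_std_normal (f := fun x => (x ^+ 2)%:E))//.
  - exact: normal_integral_sqr.
  - by move=> x; rewrite lee_fin sqr_ge0.
  - by apply/measurable_EFinP; exact: measurable_funX.
have EZZ i j : (\int[P]_t (Z i t ^+ 2 * Z j t ^+ 2)%:E
    <= (if i == j then q else 0) + 1)%E.
  have [<-|ij] := eqVneq i j.
    under eq_integral do rewrite -exprD.
    rewrite (ge0_integral_std_normal (f := fun x => (x ^+ 4)%:E))//.
    + by rewrite leeDl.
    + by move=> x; rewrite lee_fin exprn_even_ge0.
    + by apply/measurable_EFinP; exact: measurable_funX.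
  by rewrite integral_sqr_mul_indep ?add0e//; exact: iZ.
have ESS : (\int[P]_t (S t ^+ 2)%:E <= m%:R%:E * q + (m%:R ^+ 2)%:E)%E.
  have -> : (\int[P]_t (S t ^+ 2)%:E =
      \sum_(i < m) \sum_(j < m) \int[P]_t (Z i t ^+ 2 * Z j t ^+ 2)%:E)%E.
    transitivity (\int[P]_t
        \sum_(i < m) \sum_(j < m) (Z i t ^+ 2 * Z j t ^+ 2)%:E)%E.
      apply: eq_integral => t _; rewrite expr2 /S mulr_suml -sumEFin.
      by apply: eq_bigr => i _; rewrite mulr_sumr -sumEFin.
    rewrite ge0_integral_sum//; last 2 first.
    - move=> i; apply: emeasurable_sum => j.
      by apply/measurable_EFinP; exact: measurable_funM.
    - by move=> i t _; apply: sume_ge0 => j _; rewrite lee_fin mulr_ge0 ?sqr_ge0.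
    apply: eq_bigr => i _; rewrite ge0_integral_sum//.
    - by move=> j; apply/measurable_EFinP; exact: measurable_funM.
    - by move=> j t _; rewrite lee_fin mulr_ge0 ?sqr_ge0.
  apply: (@le_trans _ _ (\sum_(i < m) (q + m%:R%:E))%E).
    apply: lee_sum => i _; apply: le_trans (lee_sum _ (fun j _ => EZZ i j)) _.
    rewrite big_split/= sumEFin sumr_const card_ord leeD2r//.
    by rewrite (bigD1 i)//= eqxx big1 ?adde0// => j /negPf; rewrite eq_sym => ->.
  rewrite big_split/= sumEFin [X in X%:E]sumr_const card_ord expr2 mulr_natr.
  rewrite leeD2r//; under eq_bigr do rewrite -[q]mul1e.
  by rewrite -ge0_sume_distrl// sumEFin sumr_const card_ord.
have mSm : measurable_fun [set: T] (fun t => ((S t - m%:R) ^+ 2)%:E).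
  apply/measurable_EFinP; apply: measurable_funX.
  by apply: measurable_funB.
have E2S : (\int[P]_t (2 * m%:R * S t)%:E = (2 * m%:R ^+ 2)%:E)%E.
  under eq_integral do rewrite EFinM.
  rewrite ge0_integralZl//.
  - by rewrite ES -EFinM -mulrA expr2.
  - by apply/measurable_EFinP.
  - by move=> t _; rewrite lee_fin.
have key : (\int[P]_t ((S t - m%:R) ^+ 2)%:E + (2 * m%:R ^+ 2)%:E
    <= m%:R%:E * q + (2 * m%:R ^+ 2)%:E)%E.
  rewrite -[X in (_ + X <= _)%E]E2S -ge0_integralD//; last 3 first.
  - by move=> t _; rewrite lee_fin sqr_ge0.
  - by move=> t _; rewrite lee_fin !mulr_ge0.
  - by apply/measurable_EFinP; exact: measurable_funM.
  have -> : (\int[P]_t (((S t - m%:R) ^+ 2)%:E + (2 * m%:R * S t)%:E) =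
      \int[P]_t ((S t ^+ 2)%:E + (m%:R ^+ 2)%:E))%E.
    by apply: eq_integral => t _; rewrite -!EFinD; congr EFin; ring.
  rewrite ge0_integralD//; last 2 first.
  - by move=> t _; rewrite lee_fin sqr_ge0.
  - by apply/measurable_EFinP; exact: measurable_funX.
  rewrite integral_cst//= probability_setT mule1.
  apply: le_trans (leeD2r _ ESS) _.
  by rewrite -addeA -EFinD mulr_natl mulr2n.
by move: key; rewrite leeD2rE.
Qed.

(** * Measurability of matrix-valued maps *)

Lemma measurable_entry (R : realType) (m n : nat) (i : 'I_m) (j : 'I_n) :
  measurable_fun [set: borelM R m n]
    (fun M : borelM R m n => (M : 'M[R]_(m, n)) i j : measurableTypeR R).
Proof.
apply: (measurability _ (RGenOpens.measurableE R)).
move=> _ [_ [a [b ->] <-]]; rewrite setTI; apply: sub_sigma_algebra.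
have /continuousP := @coord_continuous R m n i j.
by apply; exact: interval_open.
Qed.

(** Entrywise measurability passes through the matrix operations by arithmetic
    on real functions. *)
Definition mx_measurable (R : realType) (d : measure_display)
    (T : measurableType d) (m n : nat) (F : T -> 'M[R]_(m, n)) : Prop :=
  forall i j, measurable_fun [set: T] (fun t => F t i j : measurableTypeR R).

Lemma mx_measurable_borel (R : realType) (d : measure_display)
    (T : measurableType d) (m n : nat) (F : T -> 'M[R]_(m, n)) :
  measurable_fun [set: T] (F : T -> borelM R m n) -> mx_measurable F.
Proof.
move=> mF i j.
exact: (measurableT_comp (@measurable_entry R m n i j) mF).
Qed.

Section mx_measurable.
Context (R : realType) (d : measure_display) (T : measurableType d).
Implicit Types m n p : nat.

Lemma mx_measurable_cst m n (A : 'M[R]_(m, n)) :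
  mx_measurable (fun _ : T => A).
Proof. by move=> i j; exact: measurable_cst. Qed.

Lemma mx_measurableD m n (F G : T -> 'M[R]_(m, n)) :
  mx_measurable F -> mx_measurable G -> mx_measurable (fun t => F t + G t).
Proof.
move=> mF mG i j; under eq_fun do rewrite mxE.
by apply: measurable_funD; [exact: mF|exact: mG].
Qed.

Lemma mx_measurableB m n (F G : T -> 'M[R]_(m, n)) :
  mx_measurable F -> mx_measurable G -> mx_measurable (fun t => F t - G t).
Proof.
move=> mF mG i j; under eq_fun do rewrite !mxE.
by apply: measurable_funB; [exact: mF|exact: mG].
Qed.

Lemma mx_measurable_mul m n p (F : T -> 'M[R]_(m, n)) (G : T -> 'M[R]_(n, p)) :
  mx_measurable F -> mx_measurable G -> mx_measurable (fun t => F t *m G t).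
Proof.
move=> mF mG i j; under eq_fun do rewrite mxE.
apply: measurable_sum => k.
by apply: measurable_funM; [exact: mF|exact: mG].
Qed.

Lemma mx_measurable_tr m n (F : T -> 'M[R]_(m, n)) :
  mx_measurable F -> mx_measurable (fun t => (F t)^T).
Proof. by move=> mF i j; under eq_fun do rewrite mxE; exact: mF. Qed.

Lemma measurable_det n (F : T -> 'M[R]_n) :
  mx_measurable F ->
  measurable_fun [set: T] (fun t => \det (F t) : measurableTypeR R).
Proof.
move=> mF; rewrite /determinant; apply: measurable_sum => s.
apply: measurable_funM => //.
by apply: measurable_prod => i _; exact: mF.
Qed.

(** [measurable_powR] over [measurableTypeR], the type that carries the normal
    laws. *)
Lemma measurable_powRT (p : R) : measurable_fun [set: measurableTypeR R]
  (fun x : measurableTypeR R => x `^ p : measurableTypeR R).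
Proof. exact: measurable_powR. Qed.

(** [x^-1 = x (x^2)^-1] holds at 0 as well, and [(x^2)^-1] is a power of a
    nonnegative number. *)
Lemma measurable_inv : measurable_fun [set: measurableTypeR R]
  (fun x : measurableTypeR R => x^-1 : measurableTypeR R).
Proof.
have -> : (fun x : measurableTypeR R => x^-1 : measurableTypeR R) =
    (fun x => x * ((x ^+ 2) `^ (- 1))).
  apply/funext => x; rewrite powR_inv1 ?sqr_ge0//.
  have [->|x0] := eqVneq x 0; first by rewrite invr0 mul0r.
  by rewrite expr2 invfM mulrA mulfV ?mul1r.
apply: measurable_funM => //.
apply: (measurableT_comp (measurable_powRT (- 1))).
exact: measurable_funX.
Qed.

(** Cramer's rule where the determinant is nonzero, the argument itself elsewhere. *)
Lemma mx_measurable_inv n (F : T -> 'M[R]_n) :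
  mx_measurable F -> mx_measurable (fun t => invmx (F t)).
Proof.
move=> mF i j.
have -> : (fun t => invmx (F t) i j) =
    (fun t => if \det (F t) == 0 then F t i j
              else (\det (F t))^-1 * \adj (F t) i j).
  apply/funext => t; rewrite /invmx unitmxE unitfE.
  by case: eqP => //= _; rewrite mxE.
have mdet := measurable_det mF.
apply: measurable_fun_ifT; [exact: measurable_fun_eqr|exact: mF|].
apply: measurable_funM; first exact: (measurableT_comp measurable_inv).
under eq_fun do rewrite mxE.
apply: measurable_funM => //; apply: measurable_det => k l.
by under eq_fun do rewrite !mxE; exact: mF.
Qed.

Lemma measurable_l2norm n (F : T -> 'cV[R]_n) :
  mx_measurable F ->
  measurable_fun [set: T] (fun t => l2norm (F t) : measurableTypeR R).
Proof.
move=> mF.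
have -> : (fun t => l2norm (F t)) = (fun t => (\sum_i F t i 0 ^+ 2) `^ 2^-1).
  apply/funext => t; rewrite powR12_sqrt//.
  by apply: sumr_ge0 => i _; exact: sqr_ge0.
apply: (measurableT_comp (measurable_powRT 2^-1)).
by apply: measurable_sum => i; apply: measurable_funX; exact: mF.
Qed.

End mx_measurable.

(** * Projections of Gaussian rows *)

Lemma measurable_row_mul (R : realType) (n : nat) (a : 'cV[R]_n) :
  measurable_fun [set: borelM R 1 n]
    (fun v : borelM R 1 n => ((v : 'rV[R]_n) *m a) 0 0 : measurableTypeR R).
Proof.
apply: mx_measurable_mul; last exact: mx_measurable_cst.
by move=> i j; exact: measurable_entry.
Qed.

Section standard_normal_rows.
Context (R : realType) (d : measure_display) (T : measurableType d).
Context (P : probability T R) (m n : nat) (X : T -> 'M[R]_(m, n)).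
Hypothesis nX : standard_normal_rows P X.
Variable a : 'cV[R]_n.

Lemma std_normal_var_proj (i : 'I_m) : (a^T *m a) 0 0 = 1 ->
  std_normal_var P (fun t => (X t *m a) i 0).
Proof.
move=> a1; have [mX /(_ i) nXi _] := nX; split.
  apply: mx_measurable_mul; last exact: mx_measurable_cst.
  exact: mx_measurable_borel.
move=> A mA; have := nXi a A mA.
rewrite mulmx0 mxE mulmx1 a1 /normal_law oner_eq0 sqrtr1 => <-.
congr (P _); apply/seteqP; split=> t /=;
  by rewrite -trmx_mul -row_mul !mxE.
Qed.

Lemma independent2_proj (i j : 'I_m) : i != j ->
  independent2 P (fun t => (X t *m a) i 0 : measurableTypeR R)
                 (fun t => (X t *m a) j 0 : measurableTypeR R).
Proof.
move=> ij A B mA mB; have [mX _ iX] := nX.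
pose f (v : borelM R 1 n) : measurableTypeR R := ((v : 'rV[R]_n) *m a) 0 0.
have mf C : measurable C -> measurable (f @^-1` C).
  by move=> mC; rewrite -[X in measurable X]setTI; exact: measurable_row_mul.
(* Only rows i and j are constrained. *)
pose D k := if k == i then f @^-1` A else if k == j then f @^-1` B else setT.
have mD k : measurable (D k).
  by rewrite /D; case: ifP => _; [exact: mf|case: ifP => _; [exact: mf|]].
have fE k t : f (row k (X t)) = (X t *m a) k 0.
  by rewrite /f -row_mul mxE.
have := iX D mD.
have -> : \bigcap_(k in [set: 'I_m])
      (fun t => row k (X t) : borelM R 1 n) @^-1` D k =
    [set t | A ((X t *m a) i 0)] `&` [set t | B ((X t *m a) j 0)].
  apply/seteqP; split=> [t tD|t [Ai Bj] k _] /=.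
    split; first by have := tD i Logic.I; rewrite /= /D eqxx /= fE.
    by have := tD j Logic.I; rewrite /= /D eq_sym (negPf ij) eqxx /= fE.
  rewrite /D; case: eqP => [->|_]; first by rewrite /= fE.
  by case: eqP => [->|_] //; rewrite /= fE.
move=> ->.
rewrite (bigD1 i)//= (bigD1 j) 1?eq_sym//= big1 => [|k /andP[ki kj]]; last first.
  by rewrite /D (negPf ki) (negPf kj) preimage_setT probability_setT.
rewrite mulr1 EFinM /D eqxx eq_sym (negPf ij) eqxx.
have fin k C : measurable C ->
    P ((fun t => row k (X t) : borelM R 1 n) @^-1` (f @^-1` C)) \is a fin_num.
  move=> mC; apply: fin_num_measure.
  rewrite (_ : _ @^-1` _ = (fun t => (X t *m a) k 0) @^-1` C).
    rewrite -[X in measurable X]setTI; apply: mx_measurable_mul => //.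
    exact: mx_measurable_borel.
  by apply/seteqP; split=> t /=; rewrite fE.
rewrite !fineK ?fin//.
by congr (P _ * P _)%E; apply/seteqP; split=> t /=; rewrite fE.
Qed.

End standard_normal_rows.

(** * Matrices close to a scalar matrix *)

Section l1norm.
Context (R : realType).

Definition l1norm n (v : 'cV[R]_n) : R := \sum_i `|v i 0|.

Lemma l1norm_ge0 n (v : 'cV[R]_n) : 0 <= l1norm v.
Proof. by apply: sumr_ge0 => i _. Qed.

Lemma l1normD n (u v : 'cV[R]_n) : l1norm (u + v) <= l1norm u + l1norm v.
Proof.
by rewrite -big_split; apply: ler_sum => i _; rewrite mxE ler_normD.
Qed.

Lemma l1normN n (v : 'cV[R]_n) : l1norm (- v) = l1norm v.
Proof. by apply: eq_bigr => i _; rewrite mxE normrN. Qed.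

Lemma l1normZ n (c : R) (v : 'cV[R]_n) : l1norm (c *: v) = `|c| * l1norm v.
Proof. by rewrite mulr_sumr; apply: eq_bigr => i _; rewrite mxE normrM. Qed.

Lemma l1norm_eq0 n (v : 'cV[R]_n) : l1norm v <= 0 -> v = 0.
Proof.
move=> v0; apply/matrixP => i j; rewrite (ord1 j) mxE; apply/eqP.
rewrite -normr_le0; apply: le_trans v0.
by rewrite /l1norm (bigD1 i)//= lerDl sumr_ge0.
Qed.

Lemma l1norm_mul m n (A : 'M[R]_(m, n)) (v : 'cV[R]_n) (delta : R) :
  (forall i j, `|A i j| <= delta) ->
  l1norm (A *m v) <= m%:R * delta * l1norm v.
Proof.
move=> Adelta; apply: (@le_trans _ _ (\sum_(i < m) delta * l1norm v)).
  apply: ler_sum => i _; rewrite mxE.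
  apply: le_trans (ler_norm_sum _ _ _) _; rewrite mulr_sumr.
  by apply: ler_sum => j _; rewrite normrM ler_wpM2r.
by rewrite sumr_const card_ord -[leLHS]mulr_natl mulrA.
Qed.

Lemma l2norm_le_l1norm n (v : 'cV[R]_n) : l2norm v <= l1norm v.
Proof.
rewrite /l2norm -[leRHS]ger0_norm ?l1norm_ge0// -sqrtr_sqr ler_wsqrtr//.
rewrite expr2 {1}/l1norm mulr_suml; apply: ler_sum => i _.
rewrite -real_normK ?num_real// expr2 ler_wpM2l//.
by rewrite /l1norm (bigD1 i)//= lerDl sumr_ge0.
Qed.

Lemma l2norm_ge0 n (v : 'cV[R]_n) : 0 <= l2norm v.
Proof. exact: sqrtr_ge0. Qed.

End l1norm.

Section near_scalar.
Context (R : realType) (n : nat) (A : 'M[R]_n) (c delta : R).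
Hypothesis Ac : forall i j, `|(A - c%:M) i j| <= delta.
Hypothesis small : n%:R * delta <= `|c| / 2.

(** From [c v = A v - (A - c I) v]: the perturbation absorbs at most half of
    [|c| |v|]. Stated without an inverse, this bounds [A^-1] and also shows that
    [A] is injective. *)
Lemma near_scalar_bound (v : 'cV[R]_n) :
  `|c| * l1norm v <= 2 * l1norm (A *m v).
Proof.
have cv : c *: v = A *m v - (A - c%:M) *m v.
  by rewrite mulmxBl mul_scalar_mx opprB addrC subrK.
have h1 : `|c| * l1norm v <= l1norm (A *m v) + `|c| / 2 * l1norm v.
  rewrite -l1normZ cv; apply: le_trans (l1normD _ _) _.
  rewrite l1normN lerD2l; apply: le_trans (l1norm_mul v Ac) _.
  by rewrite ler_wpM2r ?l1norm_ge0.
lra.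
Qed.

Lemma near_scalar_unitmx : c != 0 -> A \in unitmx.
Proof.
move=> c0; rewrite -unitmx_tr -row_free_unit -kermx_eq0.
apply/rowV0P => u /sub_kermxP uA0.
apply: trmx_inj; rewrite trmx0; apply: l1norm_eq0.
have := near_scalar_bound u^T.
have -> : A *m u^T = 0 by rewrite -[A]trmxK -trmx_mul uA0 trmx0.
have -> : l1norm (0 : 'cV[R]_n) = 0.
  by apply: big1 => i _; rewrite mxE normr0.
by rewrite mulr0 pmulr_rle0// normr_gt0.
Qed.

End near_scalar.

(** * Gram matrices from squared norms of projections *)

Section polarization.
Context (R : realType) (n : nat).

(** [e_j] on the diagonal and [(e_j + e_l) / sqrt 2] off it. These are unit
    vectors, so a standard normal row projects on each of them to a standard
    normal variable. *)
Definition pol_vec (p : 'I_n * 'I_n) : 'cV[R]_n :=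
  if p.1 == p.2 then delta_mx p.1 0
  else (Num.sqrt 2)^-1 *: (delta_mx p.1 0 + delta_mx p.2 0).

Definition sqr_dev m (X : 'M[R]_(m, n)) (a : 'cV[R]_n) : R :=
  \sum_(i < m) (X *m a) i 0 ^+ 2 - m%:R.

Lemma mul_delta m (X : 'M[R]_(m, n)) (j : 'I_n) (i : 'I_m) :
  (X *m (delta_mx j 0 : 'cV[R]_n)) i 0 = X i j.
Proof. by rewrite -colE mxE. Qed.

Lemma gramE m (X : 'M[R]_(m, n)) j l : (X^T *m X) j l = \sum_i X i j * X i l.
Proof. by rewrite mxE; apply: eq_bigr => i _; rewrite mxE. Qed.

Lemma gram_devE m (X : 'M[R]_(m, n)) j l :
  (X^T *m X - m%:R%:M) j l = \sum_i X i j * X i l - m%:R *+ (j == l).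
Proof. by rewrite -gramE !mxE. Qed.

Lemma sqr_dev_diag m (X : 'M[R]_(m, n)) j :
  sqr_dev X (pol_vec (j, j)) = (X^T *m X - m%:R%:M) j j.
Proof.
rewrite gram_devE /sqr_dev /pol_vec eqxx; congr (_ - _).
by apply: eq_bigr => i _; rewrite mul_delta expr2.
Qed.

Lemma sqr_dev_offdiag m (X : 'M[R]_(m, n)) j l : j != l ->
  sqr_dev X (pol_vec (j, l)) = (X^T *m X - m%:R%:M) j l
    + (X^T *m X - m%:R%:M) j j / 2 + (X^T *m X - m%:R%:M) l l / 2.
Proof.
move=> jl; rewrite /sqr_dev /pol_vec/= (negPf jl) !gram_devE !eqxx (negPf jl).
have -> : \sum_(i < m)
    (X *m ((Num.sqrt 2)^-1 *: (delta_mx j 0 + delta_mx l 0) : 'cV[R]_n)) i 0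
      ^+ 2 =
    \sum_i X i j * X i l + (\sum_i X i j * X i j) / 2
    + (\sum_i X i l * X i l) / 2.
  rewrite !mulr_suml -!big_split/=; apply: eq_bigr => i _.
  rewrite -scalemxAr mulmxDr 2!mxE !mul_delta exprMn exprVn sqr_sqrtr//.
  by field.
by rewrite mulr0n mulr1n; field.
Qed.

Lemma pol_vec_unit p : ((pol_vec p)^T *m pol_vec p) 0 0 = 1.
Proof.
case: p => j l; rewrite /pol_vec/=.
have D (k k' : 'I_n) : 
    ((delta_mx k 0 : 'cV[R]_n)^T *m (delta_mx k' 0 : 'cV[R]_n)) 0 0 =
    (k == k')%:R :> R.
  by rewrite trmx_delta mul_delta mxE eqxx/= eq_sym.
case: (eqVneq j l) => [_|jl]; first by rewrite D eqxx.
have Z (c : R) (u : 'cV[R]_n) :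
    ((c *: u)^T *m (c *: u)) 0 0 = c ^+ 2 * (u^T *m u) 0 0.
  by rewrite !mxE mulr_sumr; apply: eq_bigr => i _; rewrite !mxE; ring.
have add (u v : 'cV[R]_n) : ((u + v)^T *m (u + v)) 0 0 =
    (u^T *m u) 0 0 + (u^T *m v) 0 0 + (v^T *m u) 0 0 + (v^T *m v) 0 0.
  rewrite !mxE -!big_split/=; apply: eq_bigr => i _.
  by rewrite !mxE; ring.
rewrite Z add !D !eqxx (negPf jl) eq_sym (negPf jl) exprVn sqr_sqrtr//.
by rewrite !addr0/= -natrD mulVf.
Qed.

(** By [sqr_dev_offdiag] an off-diagonal entry is one deviation minus half of
    two others, whence the factor 2. *)
Lemma gram_dev_le m (X : 'M[R]_(m, n)) (s : R) :
  (forall p, `|sqr_dev X (pol_vec p)| <= s) ->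
  forall j l, `|(X^T *m X - m%:R%:M) j l| <= 2 * s.
Proof.
move=> Xs j l.
have Xd k : `|(X^T *m X - m%:R%:M) k k| <= s by rewrite -sqr_dev_diag.
have s0 : 0 <= s := le_trans (normr_ge0 _) (Xs (j, l)).
case: (eqVneq j l) => [<-|jl]; first by apply: le_trans (Xd j) _; lra.
have := Xs (j, l); rewrite (sqr_dev_offdiag _ jl).
move: (Xd j) (Xd l); rewrite !ler_norml => /andP[? ?] /andP[? ?] /andP[? ?].
by apply/andP; split; lra.
Qed.

End polarization.

(** * The deterministic comparison of the two estimators *)

Section ridge_difference.
Context (R : realType) (d n0 n : nat) (beta0 : 'cV[R]_d) (nu lambda K : R).
Context (X : 'M[R]_(n0, d)) (W : 'M[R]_(n - n0, d)) (e : 'cV[R]_n0).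
Hypothesis lambdaN1 : lambda != -1.
Hypothesis n_gt0 : (0 < n)%N.
Hypothesis n0n : (n0 <= n)%N.
Hypothesis n0nu : `|n0%:R - n%:R * nu| <= 1.
Hypothesis K1 : 1 <= K.

Let s : R := Num.sqrt (K * n%:R).

Hypothesis ds : d%:R * (4 * s) <= `|n%:R * (1 + lambda)| / 2.
Hypothesis Xs : forall p, `|sqr_dev X (pol_vec R p)| <= s.
Hypothesis Ws : forall p, `|sqr_dev W (pol_vec R p)| <= s.
Hypothesis es : \sum_i e i 0 ^+ 2 <= K * n%:R.

Let y := response X beta0 e.

Let n1 : 1 <= n%:R :> R.
Proof. by rewrite ler1n. Qed.

Let Kn1 : 1 <= K * n%:R.
Proof. by rewrite mulr_ege1. Qed.

Let s1 : 1 <= s.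
Proof. by rewrite /s -[leLHS]sqrtr1 ler_wsqrtr. Qed.

Let s2 : s ^+ 2 = K * n%:R.
Proof. by rewrite sqr_sqrtr// (le_trans ler01). Qed.

Let s_le : s <= K * n%:R.
Proof. by rewrite -s2 expr2 ler_peMl// (le_trans ler01). Qed.

Let n0R : n0%:R <= n%:R :> R.
Proof. by rewrite ler_nat. Qed.

Let G := X^T *m X - n0%:R%:M.
Let H := W^T *m W - (n - n0)%:R%:M.
Let A := X^T *m X + W^T *m W + (n%:R * lambda)%:M.
Let B := X^T *m X + (n%:R * (1 - nu + lambda))%:M.
Let c := n%:R * (1 + lambda).
Let u := X^T *m y.

Let Gs j l : `|G j l| <= 2 * s. Proof. exact: gram_dev_le. Qed.
Let Hs j l : `|H j l| <= 2 * s. Proof. exact: gram_dev_le. Qed.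

Let scalar_entry (x : R) (j l : 'I_d) : `|x| <= 1 -> `|x%:M j l| <= 1.
Proof. by move=> x1; rewrite mxE; case: eqP; rewrite // normr0 ler01. Qed.

Let Ac j l : `|(A - c%:M) j l| <= 4 * s.
Proof.
have -> : A - c%:M = G + H.
  rewrite /A /c /G /H natrB// mulrDr mulr1 !raddfD/= raddfN/=.
  apply/matrixP => i k; rewrite !mxE; ring.
rewrite mxE; apply: le_trans (ler_normD _ _) _.
by have := Gs j l; have := Hs j l; lra.
Qed.

Let Bc j l : `|(B - c%:M) j l| <= 4 * s.
Proof.
have -> : B - c%:M = G + (n0%:R - n%:R * nu)%:M.
  apply/matrixP => i k; rewrite !mxE.
  by case: eqP => _; rewrite ?mulr1n ?mulr0n /c; ring.
rewrite mxE; apply: le_trans (ler_normD _ _) _.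
by have := Gs j l; have := scalar_entry j l n0nu; have := s1; lra.
Qed.

Let BA j l : `|(B - A) j l| <= 4 * s.
Proof.
have -> : B - A = (n0%:R - n%:R * nu)%:M - H.
  rewrite /H natrB//.
  apply/matrixP => i k; rewrite !mxE.
  by case: eqP => _; rewrite ?mulr1n ?mulr0n /c; ring.
rewrite mxE; apply: le_trans (ler_normD _ _) _.
rewrite [X in _ + `|X|]mxE normrN.
by have := Hs j l; have := scalar_entry j l n0nu; have := s1; lra.
Qed.

Let c_neq0 : c != 0.
Proof.
rewrite mulf_neq0// ?pnatr_eq0 -?lt0n//.
by apply: contraNneq lambdaN1 => h; apply/eqP; lra.
Qed.

Let Au : A \in unitmx. Proof. exact: near_scalar_unitmx Ac ds c_neq0. Qed.
Let Bu : B \in unitmx. Proof. exact: near_scalar_unitmx Bc ds c_neq0. Qed.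

Let gram_le j l : `|(X^T *m X) j l| <= 3 * (K * n%:R).
Proof.
have -> : (X^T *m X) j l = G j l + n0%:R%:M j l.
  by rewrite /G [in RHS]mxE [X in _ + X + _]mxE subrK.
apply: le_trans (ler_normD _ _) _.
have h : `|(n0%:R%:M : 'M[R]_d) j l| <= K * n%:R.
  have hn : n%:R <= K * n%:R by rewrite ler_peMl.
  rewrite mxE; case: eqP => _; rewrite ?mulr1n ?mulr0n ?normr0 ?normr_nat.
    exact: le_trans n0R hn.
  exact: le_trans ler01 Kn1.
by have := Gs j l; have := s_le; lra.
Qed.

(* |x e| <= (x^2 + e^2) / 2: crude, but of the right order n. *)
Let Xe_le j : `|(X^T *m e) j 0| <= 2 * (K * n%:R).
Proof.
rewrite mxE; apply: le_trans (ler_norm_sum _ _ _) _.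
have : \sum_i `|X^T j i * e i 0| <=
    2^-1 * ((X^T *m X) j j + \sum_i e i 0 ^+ 2).
  rewrite gramE -big_split/= mulr_sumr; apply: ler_sum => i _.
  rewrite mxE normrM -(real_normK (num_real (e i 0))) -expr2.
  rewrite -(real_normK (num_real (X i j))).
  have := sqr_ge0 (`|X i j| - `|e i 0|); rewrite sqrrB; lra.
move/le_trans; apply.
by have := gram_le j j; rewrite ler_norml => /andP[_]; move: es; lra.
Qed.

Let u_le : l1norm u <= d%:R * (3 * l1norm beta0 + 2) * (K * n%:R).
Proof.
rewrite /u /y /response mulmxDr mulmxA; apply: le_trans (l1normD _ _) _.
rewrite mulrDr mulrDl; apply: lerD.
  apply: le_trans (l1norm_mul beta0 gram_le) _.
  by rewrite le_eqVlt; apply/orP; left; apply/eqP; ring.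
rewrite /l1norm; apply: le_trans (ler_sum _ (fun j _ => Xe_le j)) _.
by rewrite sumr_const card_ord -[leLHS]mulr_natl -mulrA lexx.
Qed.

(** [near_scalar_bound] is used twice: on [B] to bound [v2 = B^-1 u] by
    [2 |u| / |c|], and on [A] to bound [v1 - v2] through
    [A (v1 - v2) = (B - A) v2]. The powers of [n] then balance to
    [sqrt n . n / n^2]. *)
Lemma ridge_difference_le :
  l2norm (ridgeII (n%:R * lambda) y X W - ridge (n%:R * (1 - nu + lambda)) y X)
  <= 16 * d%:R * (d%:R * (3 * l1norm beta0 + 2)) * (K * Num.sqrt K)
       / (1 + lambda) ^+ 2 * n%:R `^ (- 2^-1).
Proof.
rewrite ridgeIIE /ridge -!mulmxA -/u -/A -/B.
set v1 := invmx A *m u; set v2 := invmx B *m u.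
apply: le_trans (l2norm_le_l1norm _) _.
have Av1 : A *m v1 = u by rewrite mulKVmx.
have Bv2 : B *m v2 = u by rewrite mulKVmx.
have hv2 : `|c| * l1norm v2 <= 2 * l1norm u.
  by rewrite -Bv2; exact: near_scalar_bound Bc ds _.
have hD : `|c| * l1norm (v1 - v2) <= 2 * (d%:R * (4 * s) * l1norm v2).
  apply: le_trans (near_scalar_bound Ac ds _) _; rewrite ler_pM2l//.
  have -> : A *m (v1 - v2) = (B - A) *m v2.
    by rewrite mulmxBr mulmxBl Av1 Bv2.
  exact: l1norm_mul.
have n0' : 0 < n%:R :> R by rewrite ltr0n.
have l0 : 0 < (1 + lambda) ^+ 2.
  by rewrite exprn_even_gt0//= addrC addr_eq0.
have c2 : `|c| * `|c| = n%:R ^+ 2 * (1 + lambda) ^+ 2.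
  by rewrite -expr2 real_normK ?num_real// exprMn.
have key : n%:R ^+ 2 * (1 + lambda) ^+ 2 * l1norm (v1 - v2) <=
    16 * d%:R * s * (d%:R * (3 * l1norm beta0 + 2) * (K * n%:R)).
  rewrite -c2 -[leLHS]mulrA.
  apply: (@le_trans _ _ (`|c| * (2 * (d%:R * (4 * s) * l1norm v2)))).
    by rewrite ler_wpM2l.
  have -> : `|c| * (2 * (d%:R * (4 * s) * l1norm v2)) =
    8 * d%:R * s * (`|c| * l1norm v2) by ring.
  have ds0 : 0 <= 8 * d%:R * s by rewrite !mulr_ge0// (le_trans ler01).
  apply: (le_trans (ler_wpM2l ds0 hv2)).
  have -> : 8 * d%:R * s * (2 * l1norm u) = 16 * d%:R * s * l1norm u by ring.
  by rewrite ler_wpM2l// !mulr_ge0// (le_trans ler01).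
rewrite powRN powR12_sqrt ?ler0n//.
have sq0 : 0 < Num.sqrt n%:R :> R by rewrite sqrtr_gt0.
have nE : n%:R = Num.sqrt n%:R ^+ 2 :> R by rewrite sqr_sqrtr// ltW.
have sE : s = Num.sqrt K * Num.sqrt n%:R.
  by rewrite /s sqrtrM// (le_trans ler01).
have nl0 : 0 < n%:R ^+ 2 * (1 + lambda) ^+ 2 by rewrite mulr_gt0// exprn_gt0.
rewrite -(ler_pM2l nl0); apply: le_trans key _.
set a := Num.sqrt n%:R in sE nE sq0 *; set L := (1 + lambda) ^+ 2 in l0 *.
rewrite sE nE le_eqVlt; apply/orP; left; apply/eqP.
have a0 : a != 0 by rewrite gt_eqF.
have L0 : L != 0 by rewrite gt_eqF.
move: (Num.sqrt K) => k; clearbody a L; field.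
by rewrite a0 L0.
Qed.

End ridge_difference.

(** * Expectation of the total deviation *)

Lemma measurable_superlevel (R : realType) (d : measure_display)
    (T : measurableType d) (Y : T -> R) (a : R) :
  measurable_fun [set: T] (Y : T -> measurableTypeR R) ->
  measurable [set t | a < Y t].
Proof.
move=> mY; have -> : [set t | a < Y t] = Y @^-1` `]a, +oo[%classic.
  by apply/seteqP; split=> t /=; rewrite in_itv/= andbT.
by rewrite -[X in measurable X]setTI; apply: mY.
Qed.

Lemma markov_ineq (R : realType) (d : measure_display) (T : measurableType d)
    (P : probability T R) (Y : T -> R) (c a : R) :
    measurable_fun [set: T] (Y : T -> measurableTypeR R) ->
    (forall t, 0 <= Y t) -> (\int[P]_t (Y t)%:E <= c%:E)%E -> 0 < a ->
  (P [set t | (a < Y t)%R] <= (c / a)%:E)%E.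
Proof.
move=> mY Y0 EY a0.
have mYE : measurable_fun [set: T] (fun t => (Y t)%:E) by apply/measurable_EFinP.
have mge : measurable [set t | (a%:E <= `|(Y t)%:E|)%E].
  rewrite -[X in measurable X]setTI.
  by apply: emeasurable_fun_c_infty => //; exact: measurableT_comp.
have mgt := measurable_superlevel a mY.
have := @le_integral_comp_abse _ _ _ P _ measurableT (fun t => (Y t)%:E) a id.
rewrite setTI => /(_ _ _ _ mYE a0) H.
rewrite EFinM lee_pdivlMr// muleC.
apply: le_trans EY.
apply: (@le_trans _ _ (a%:E * P [set t | (a%:E <= `|(Y t)%:E|)%E])%E).
  rewrite lee_pmul2l// ?lte_fin//.
  apply: le_measure; rewrite ?inE// => t /= aY.
  by rewrite lee_fin ger0_norm// ltW.
apply: le_trans (H _ _ _) _ => //.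
by under eq_integral do rewrite gee0_abs ?lee_fin//.
Qed.

Section moments.
Context (R : realType) (dT : measure_display) (T : measurableType dT).
Context (P : probability T R) (m d : nat).

Local Notation q := (\int[normal_prob 0 1]_x (x ^+ 4)%:E)%E.

Lemma measurable_sqr_dev (X : T -> 'M[R]_(m, d)) (a : 'cV[R]_d) :
  mx_measurable X ->
  measurable_fun [set: T] (fun t => sqr_dev (X t) a : measurableTypeR R).
Proof.
move=> mX; apply: measurable_funB => //; apply: measurable_sum => i.
by apply: measurable_funX; apply: mx_measurable_mul.
Qed.

Lemma integral_sqr_dev_le (X : T -> 'M[R]_(m, d)) (a : 'cV[R]_d) :
    standard_normal_rows P X -> (a^T *m a) 0 0 = 1 ->
  (\int[P]_t (sqr_dev (X t) a ^+ 2)%:E <= m%:R%:E * q)%E.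
Proof.
move=> nX a1.
apply: (integral_chi2_sqr_le (Z := fun i t => (X t *m a) i 0)) => [i|i j ij].
  exact: std_normal_var_proj.
exact: independent2_proj.
Qed.

Definition gram_dev n (X : 'M[R]_(n, d)) : R :=
  \sum_p sqr_dev X (pol_vec R p) ^+ 2.

Lemma integral_gram_dev_le (X : T -> 'M[R]_(m, d)) :
    standard_normal_rows P X ->
  (\int[P]_t (gram_dev (X t))%:E <= ((d * d)%:R * m%:R)%:E * q)%E.
Proof.
move=> nX; have mX := mx_measurable_borel (snr_measurable nX).
under eq_integral do rewrite /gram_dev -sumEFin.
rewrite ge0_integral_sum//; last 2 first.
- move=> p; apply/measurable_EFinP; apply: measurable_funX.
  exact: measurable_sqr_dev.
- by move=> p t _; rewrite lee_fin sqr_ge0.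
apply: (@le_trans _ _ (\sum_(p : 'I_d * 'I_d) m%:R%:E * q)%E).
  by apply: lee_sum => p _; apply: integral_sqr_dev_le => //; exact: pol_vec_unit.
rewrite -ge0_sume_distrl; last by move=> p _; rewrite lee_fin.
by rewrite sumEFin sumr_const card_prod card_ord -[X in (X%:E * _ <= _)%E]mulr_natl.
Qed.

(** Each [e_i / sigma] is standard normal, with second moment 1. *)
Lemma integral_noise_sqr (sigma2 : R) (e : T -> 'cV[R]_m) :
    0 < sigma2 -> mx_measurable e -> multivariate_normal P e 0 sigma2%:M ->
  (\int[P]_t (\sum_i e t i 0 ^+ 2)%:E = (m%:R * sigma2)%:E)%E.
Proof.
move=> s0 me ne; pose s := Num.sqrt sigma2.
have sgt0 : 0 < s by rewrite sqrtr_gt0.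
have sE : s ^+ 2 = sigma2 by rewrite sqr_sqrtr// ltW.
have nZ i : std_normal_var P (fun t => s^-1 * e t i 0).
  split; first by apply: measurable_funM => //; exact: me.
  move=> A mA; have := ne (s^-1 *: delta_mx i 0) A mA.
  have D (v : 'cV[R]_m) : ((s^-1 *: delta_mx i 0)^T *m v) 0 0 = s^-1 * v i 0.
    rewrite mxE (bigD1 i)//= big1 => [|k /negPf ki].
      by rewrite !mxE !eqxx/= mulr1 addr0.
    by rewrite !mxE ki/= mulr0 mul0r.
  rewrite !D mul_mx_scalar -scalemxAl.
  have -> : (0 : 'cV[R]_m) i 0 = 0 by rewrite mxE.
  rewrite [X in normal_law _ X]mxE D mulr0.
  have -> : (s^-1 *: delta_mx i 0 : 'cV[R]_m) i 0 = s^-1.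
    by rewrite !mxE !eqxx mulr1.
  rewrite -invfM -expr2 sE mulfV ?gt_eqF//.
  rewrite /normal_law oner_eq0 sqrtr1 => <-.
  by congr (P _); apply/seteqP; split=> t /=; rewrite D.
under eq_integral do rewrite -sumEFin.
rewrite ge0_integral_sum//; last 2 first.
- by move=> i; apply/measurable_EFinP; apply: measurable_funX; exact: me.
- by move=> i t _; rewrite lee_fin sqr_ge0.
rewrite (eq_bigr (fun=> sigma2%:E)) => [|i _].
  by rewrite sumEFin sumr_const card_ord mulr_natl.
transitivity (\int[P]_t (sigma2%:E * ((s^-1 * e t i 0) ^+ 2)%:E))%E.
  apply: eq_integral => t _; rewrite -EFinM; congr EFin.
  by rewrite exprMn exprVn sE mulrA mulfV ?mul1r// gt_eqF.
rewrite ge0_integralZl//; last 3 first.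
- apply/measurable_EFinP; apply: measurable_funX; apply: measurable_funM => //.
  exact: me.
- by move=> t _; rewrite lee_fin sqr_ge0.
- by rewrite lee_fin ltW.
rewrite (ge0_integral_std_normal (f := fun x => (x ^+ 2)%:E) (nZ i)).
- by rewrite normal_integral_sqr mule1.
- by move=> x; rewrite lee_fin sqr_ge0.
- by apply/measurable_EFinP; exact: measurable_funX.
Qed.

End moments.

Section total_deviation.
Context (R : realType) (d : nat).

Definition total_dev n0 p (X : 'M[R]_(n0, d)) (e : 'cV[R]_n0)
    (W : 'M[R]_(p, d)) : R :=
  gram_dev X + gram_dev W + \sum_i e i 0 ^+ 2.

Lemma gram_dev_ge0 n (X : 'M[R]_(n, d)) : 0 <= gram_dev X.
Proof. by apply: sumr_ge0 => p _; exact: sqr_ge0. Qed.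

Lemma sum_sqr_ge0 n (e : 'cV[R]_n) : 0 <= \sum_i e i 0 ^+ 2.
Proof. by apply: sumr_ge0 => p _; exact: sqr_ge0. Qed.

Lemma sqr_dev_le n (X : 'M[R]_(n, d)) (c : R) : gram_dev X <= c ->
  forall p, `|sqr_dev X (pol_vec R p)| <= Num.sqrt c.
Proof.
move=> Xc p; rewrite -sqrtr_sqr ler_wsqrtr//; apply: le_trans Xc.
by rewrite /gram_dev (bigD1 p)//= lerDl sumr_ge0// => k _; exact: sqr_ge0.
Qed.

Section random.
Context (dT : measure_display) (T : measurableType dT) (P : probability T R).

Lemma measurable_gram_dev n (X : T -> 'M[R]_(n, d)) : mx_measurable X ->
  measurable_fun [set: T] (fun t => gram_dev (X t) : measurableTypeR R).
Proof.
move=> mX; apply: measurable_sum => p; apply: measurable_funX.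
exact: measurable_sqr_dev.
Qed.

Lemma measurable_sum_sqr n (e : T -> 'cV[R]_n) : mx_measurable e ->
  measurable_fun [set: T] (fun t => \sum_i e t i 0 ^+ 2 : measurableTypeR R).
Proof.
by move=> me; apply: measurable_sum => i; apply: measurable_funX; exact: me.
Qed.

Context (n0 n : nat) (sigma2 : R).
Context (X : T -> 'M[R]_(n0, d)) (e : T -> 'cV[R]_n0)
        (W : T -> 'M[R]_(n - n0, d)).
Hypothesis XeW : sequenceII P sigma2 X e W.

Let mX : mx_measurable X.
Proof. exact: mx_measurable_borel (snr_measurable (sII_X XeW)). Qed.
Let mW : mx_measurable W.
Proof. exact: mx_measurable_borel (snr_measurable (sII_W XeW)). Qed.
Let me : mx_measurable e.
Proof. exact: mx_measurable_borel (sII_e_measurable XeW). Qed.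

Lemma measurable_total_dev : measurable_fun [set: T]
  (fun t => total_dev (X t) (e t) (W t) : measurableTypeR R).
Proof.
apply: measurable_funD; last exact: measurable_sum_sqr.
by apply: measurable_funD; exact: measurable_gram_dev.
Qed.

Lemma integral_total_dev_le : 0 < sigma2 -> (n0 <= n)%N ->
  (\int[P]_t (total_dev (X t) (e t) (W t))%:E <=
   (((d * d)%:R * fine (\int[normal_prob 0 1]_x (x ^+ 4)%:E) + sigma2)
      * n%:R)%:E)%E.
Proof.
move=> s0 n0n; set q := (\int[normal_prob 0 1]_x (x ^+ 4)%:E)%E.
have q0 : (0 <= q)%E.
  by apply: integral_ge0 => x _; rewrite lee_fin exprn_even_ge0.
have qE : q = (fine q)%:E.
  by rewrite fineK// ge0_fin_numE// normal_integral_exprn4_lty.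
under eq_integral do rewrite /total_dev 2!EFinD.
rewrite ge0_integralD//; last 4 first.
- by move=> t _; rewrite -EFinD lee_fin addr_ge0 ?gram_dev_ge0.
- apply/measurable_EFinP.
  by apply: measurable_funD; exact: measurable_gram_dev.
- by move=> t _; rewrite lee_fin sum_sqr_ge0.
- by apply/measurable_EFinP; exact: measurable_sum_sqr.
rewrite ge0_integralD//; last 4 first.
- by move=> t _; rewrite lee_fin gram_dev_ge0.
- by apply/measurable_EFinP; exact: measurable_gram_dev.
- by move=> t _; rewrite lee_fin gram_dev_ge0.
- by apply/measurable_EFinP; exact: measurable_gram_dev.
have hX := integral_gram_dev_le (sII_X XeW).
have hW := integral_gram_dev_le (sII_W XeW).
rewrite (integral_noise_sqr s0 me (sII_e_normal XeW)).
apply: le_trans (leeD2r _ (leeD hX hW)) _.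
rewrite -/q qE -!EFinM -!EFinD lee_fin natrB//.
have n0R : n0%:R <= n%:R :> R by rewrite ler_nat.
have : n0%:R * sigma2 <= n%:R * sigma2 by rewrite ler_wpM2r// ltW.
nra.
Qed.

End random.

End total_deviation.

(** * The stochastic order of the difference *)

(** A probability is monotone on measurable sets, hence the need for
    measurability of the event to be estimated. *)
Lemma measurable_ridge_difference (R : realType) (dT : measure_display)
    (T : measurableType dT) (P : probability T R) (d n0 n : nat)
    (sigma2 mu mu' : R) (beta0 : 'cV[R]_d)
    (X : T -> 'M[R]_(n0, d)) (e : T -> 'cV[R]_n0)
    (W : T -> 'M[R]_(n - n0, d)) :
    sequenceII P sigma2 X e W ->
  measurable_fun [set: T] (fun t => l2norm
    (ridgeII mu (response (X t) beta0 (e t)) (X t) (W t)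
     - ridge mu' (response (X t) beta0 (e t)) (X t)) : measurableTypeR R).
Proof.
move=> XeW.
have mX : mx_measurable X.
  exact: mx_measurable_borel (snr_measurable (sII_X XeW)).
have mW : mx_measurable W.
  exact: mx_measurable_borel (snr_measurable (sII_W XeW)).
have me : mx_measurable e.
  exact: mx_measurable_borel (sII_e_measurable XeW).
have mg n1 (Y : T -> 'M[R]_(n1, d)) : mx_measurable Y ->
    mx_measurable (fun t => (Y t)^T *m Y t).
  by move=> mY; apply: mx_measurable_mul => //; exact: mx_measurable_tr.
have my : mx_measurable (fun t => response (X t) beta0 (e t)).
  by apply: mx_measurableD => //; apply: mx_measurable_mul.
apply: measurable_l2norm; under eq_fun do rewrite ridgeIIE /ridge.
apply: mx_measurableB.
  apply: mx_measurable_mul => //; apply: mx_measurable_mul.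
    apply: mx_measurable_inv; apply: mx_measurableD; last exact: mx_measurable_cst.
    by apply: mx_measurableD; exact: mg.
  exact: mx_measurable_tr.
apply: mx_measurable_mul => //; apply: mx_measurable_mul.
  apply: mx_measurable_inv; apply: mx_measurableD; last exact: mx_measurable_cst.
  exact: mg.
exact: mx_measurable_tr.
Qed.

Unset Implicit Arguments.

(* The total size runs through a sequence [n k] tending to infinity. The
   hypothesis on [n0] allows n nu to be rounded up or down when it is not an
   integer, and contains the case of equality. [lambda = -1] has to be excluded:
   there n (1 - nu + lambda) = - n nu and both normalized Gram matrices
   have a singular limit. *)
Theorem theorem3p5 (R : realType) (d0 : nat) (beta0 : 'cV[R]_d0)
    (sigma2 nu lambda : R) (n n0 : nat -> nat)
    (dT : nat -> measure_display) (T : forall k, measurableType (dT k))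
    (P : forall k, probability (T k) R)
    (X : forall k, T k -> 'M[R]_(n0 k, d0))
    (e : forall k, T k -> 'cV[R]_(n0 k))
    (W : forall k, T k -> 'M[R]_(n k - n0 k, d0)) :
  0 < sigma2 ->
  0 < nu < 1 ->
  lambda != -1 ->
  n k @[k --> \oo] --> \oo ->
  (forall k, `|(n0 k)%:R - (n k)%:R * nu| < 1) ->
  (forall k, sequenceII (P k) sigma2 (X k) (e k) (W k)) ->
  bigO_p P
    (fun k t =>
       let y := response (X k t) beta0 (e k t) in
       l2norm (ridgeII ((n k)%:R * lambda) y (X k t) (W k t)
               - ridge ((n k)%:R * (1 - nu + lambda)) y (X k t)))
    (fun k => (n k)%:R `^ (- 2^-1)).
Proof.
move=> s0 /andP[nu0 nu1] lN1 noo n0nu XeW eps eps0.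
pose q : R := fine (\int[normal_prob 0 1]_x (x ^+ 4)%:E)%E.
have q0 : 0 <= q.
  by apply: fine_ge0; apply: integral_ge0 => x _; rewrite lee_fin exprn_even_ge0.
pose c0 : R := (d0 * d0)%:R * q + sigma2.
have c00 : 0 < c0 by rewrite ltr_wpDl// mulr_ge0.
(* Markov bounds the probability that total_dev exceeds K n by c0 / K <= eps. *)
pose K : R := 1 + c0 / eps.
have K1 : 1 <= K by rewrite lerDl divr_ge0// ltW.
have K0 : 0 < K by exact: lt_le_trans K1.
pose C : R := 16 * d0%:R * (d0%:R * (3 * l1norm beta0 + 2)) * (K * Num.sqrt K)
  / (1 + lambda) ^+ 2.
have C0 : 0 <= C.
  rewrite divr_ge0 ?sqr_ge0// !mulr_ge0//; last exact: ltW.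
  by rewrite addr_ge0 ?mulr_ge0 ?l1norm_ge0.
(* C may vanish, for instance when d0 = 0, and M has to be positive. *)
exists (C + 1); first by rewrite ltr_wpDl.
have l1 : 0 < `|1 + lambda| by rewrite normr_gt0 addrC addr_eq0.
(* For n >= x, the first summand gives n0 <= n, so that the truncated difference
   n - n0 is a true one, and the second makes a perturbation of
   size sqrt (K n) small against n |1 + lambda|. *)
pose x : R := (1 - nu)^-1 + (8 * d0%:R * Num.sqrt K / `|1 + lambda|) ^+ 2.
have x0 : 0 <= x by rewrite addr_ge0 ?sqr_ge0// invr_ge0 subr_ge0 ltW.
have /cvgnyPge/(_ (Num.bound x)) nN := noo.
near=> k.
have xn : x <= (n k)%:R.
  apply: le_trans (ltW (archi_boundP x0)) _; rewrite ler_nat.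
  by near: k.
have nu'0 : 0 < 1 - nu by rewrite subr_gt0.
have xn1 : 1 <= (n k)%:R * (1 - nu).
  rewrite -ler_pdivrMr// mul1r; apply: le_trans xn.
  by rewrite lerDl sqr_ge0.
have xn2 : 8 * d0%:R * Num.sqrt K / `|1 + lambda| <= Num.sqrt (n k)%:R.
  rewrite -[leLHS]ger0_norm ?divr_ge0 ?mulr_ge0// -sqrtr_sqr ler_wsqrtr//.
  by apply: le_trans xn; rewrite lerDr invr_ge0 ltW.
have n_gt0 : (0 < n k)%N.
  rewrite lt0n; apply/eqP => nk0; move: xn1; rewrite nk0 mul0r; lra.
have n0n : (n0 k <= n k)%N.
  have := n0nu k; rewrite ltr_norml => /andP[_ h].
  by rewrite -(ler_nat R); move: xn1; lra.
have ds : d0%:R * (4 * Num.sqrt (K * (n k)%:R)) <=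
    `|(n k)%:R * (1 + lambda)| / 2.
  rewrite sqrtrM ?(ltW K0)// normrM normr_nat.
  rewrite ler_pdivrMr// in xn2.
  have := ler_wpM2l (sqrtr_ge0 (n k)%:R) xn2.
  by rewrite [leRHS]mulrA -expr2 sqr_sqrtr//; lra.
have mZ := measurable_ridge_difference ((n k)%:R * lambda)
  ((n k)%:R * (1 - nu + lambda)) beta0 (XeW k).
have mD := measurable_total_dev (XeW k).
have Kn0 : 0 < K * (n k)%:R by rewrite mulr_gt0// ltr0n.
apply: (@le_trans _ _
  (P k [set t | (K * (n k)%:R < total_dev (X k t) (e k t) (W k t))%R])).
  apply: le_measure; rewrite ?inE.
  - by apply: measurable_superlevel; exact: (measurableT_comp _ mZ).
  - exact: measurable_superlevel.
  move=> t /=; apply: contraTT; rewrite -!leNgt => tot.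
  have gX : gram_dev (X k t) <= K * (n k)%:R.
    apply: le_trans tot; rewrite /total_dev -addrA lerDl addr_ge0//.
      exact: gram_dev_ge0.
    exact: sum_sqr_ge0.
  have gW : gram_dev (W k t) <= K * (n k)%:R.
    apply: le_trans tot; rewrite /total_dev addrAC lerDr addr_ge0//.
      exact: gram_dev_ge0.
    exact: sum_sqr_ge0.
  have ge : \sum_i e k t i 0 ^+ 2 <= K * (n k)%:R.
    by apply: le_trans tot; rewrite /total_dev lerDr addr_ge0 ?gram_dev_ge0.
  rewrite ger0_norm ?l2norm_ge0//.
  apply: le_trans (ridge_difference_le beta0 lN1 n_gt0 n0n (ltW (n0nu k)) K1 ds
    (sqr_dev_le gX) (sqr_dev_le gW) ge) _.
  by rewrite -/C ler_wpM2r ?powR_ge0// lerDl.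
apply: le_trans (markov_ineq mD _ (integral_total_dev_le (XeW k) s0 n0n) Kn0) _.
  move=> t; rewrite /total_dev !addr_ge0 ?gram_dev_ge0//.
  exact: sum_sqr_ge0.
rewrite -/q -/c0 lee_fin -mulf_div mulfV ?pnatr_eq0 -?lt0n// mulr1.
rewrite ler_pdivrMr//.
have -> : eps * K = eps + c0 by rewrite /K mulrDr mulr1 mulrCA mulfV ?mulr1// gt_eqF.
by rewrite lerDr ltW.
Unshelve. all: by end_near.
Qed.
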